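(* Let $n$ be a prime. There exists a globally simple $\mathrm{N}\mathrm{H}_t(n;n)$ for every admissible $t$, that is, for every positive divisor $t$ of $2n^2$.
   Context: Let $n,t\ge 1$ be integers with $t$ dividing $2n^2$ (such $t$ are called admissible), let $v=2n^2+t$, and let $J$ be the subgroup of $\mathbb{Z}_v$ of order $t$. A (square, tight, relative) non-zero sum Heffter array $\mathrm{N}\mathrm{H}_t(n;n)$ is an $n\times n$ array $A$ with no empty cells and with entries in $\mathbb{Z}_v$ such that: (i) the multiset $\{\pm x \mid x\in A\}$ contains each element of $\mathbb{Z}_v\setminus J$ exactly once (and no other element); (ii) the sum of the elements in every row and in every column is different from $0$ in $\mathbb{Z}_v$. An ordering $(t_1,\dots,t_k)$ of a finite list of elements of an abelian group is simple if its partial sums $s_i=\sum_{j=1}^i t_j$, $i=1,\dots,k$, are all non-zero and pairwise distinct. A natural ordering of a row (respectively column) is the ordering of its entries read cyclically from left to right (respectively from top to bottom) starting from some chosen entry. The array is globally simple if each row and each column admits at least one natural ordering that is simple. *)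

(* Defs.v *)
From mathcomp Require Import all_boot all_order all_algebra all_fingroup.
Set Implicit Arguments.
Unset Strict Implicit.
Unset Printing Implicit Defensive.
Import GRing.Theory.
Local Open Scope ring_scope.

Definition heffter_modulus (n t : nat) : nat := (2 * n ^ 2 + t)%N.

Definition row_seq (T : Type) (m n : nat) (A : 'M[T]_(m, n)) (i : 'I_m) : seq T :=
  [seq A i j | j <- enum 'I_n].

Definition col_seq (T : Type) (m n : nat) (A : 'M[T]_(m, n)) (j : 'I_n) : seq T :=
  [seq A i j | i <- enum 'I_m].

Definition entries (T : Type) (m n : nat) (A : 'M[T]_(m, n)) : seq T :=
  [seq A i j | i <- enum 'I_m, j <- enum 'I_n].

Definition pm_entries (V : zmodType) (m n : nat) (A : 'M[V]_(m, n)) : seq V :=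
  entries A ++ [seq - x | x <- entries A].

(* 'Z_v is the ring of integers mod v only for v > 1, which holds as soon as
   n, t >= 1. It is used here as an additive group, so J is an additive subgroup; in the
   cyclic group 'Z_v there is at most one subgroup of order t, hence the
   existential only names it. *)
Definition is_NH (n t : nat) (A : 'M['Z_(heffter_modulus n t)]_n) : Prop :=
  exists J : {group 'Z_(heffter_modulus n t)},
    [/\ #|J| = t,
        perm_eq (pm_entries A) (enum (~: J)),
        forall i : 'I_n, \sum_(j < n) A i j != 0
      & forall j : 'I_n, \sum_(i < n) A i j != 0].

Definition partial_sums (V : zmodType) (s : seq V) : seq V :=
  scanl (fun x y => x + y) 0 s.

Definition simple_ordering (V : zmodType) (s : seq V) : bool :=
  (0 \notin partial_sums s) && uniq (partial_sums s).

(* rot k s is the cyclic reading of s that starts from its entry of index k. *)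
Definition has_simple_natural_ordering (V : zmodType) (s : seq V) : Prop :=
  exists2 k : nat, (k < size s)%N & simple_ordering (rot k s).

Definition globally_simple (V : zmodType) (m n : nat) (A : 'M[V]_(m, n)) : Prop :=
  (forall i : 'I_m, has_simple_natural_ordering (row_seq A i)) /\
  (forall j : 'I_n, has_simple_natural_ordering (col_seq A j)).

(* Main.v *)
(** Let [q = 2n^2/t], so that [v = (q+1)t] and [J] consists of the multiples of
    [q+1].  The non-multiples of [q+1] below [v/2] are, in increasing order,
    [f k = k + k/q + 1] for [k < n^2].  Put [(-1)^(i+j) f(ni+j)] in cell [(i,j)]:
    along every row and every column the absolute values increase and the signs
    alternate, so each sum of consecutive entries is, as an integer, non-zero and
    at most the largest of them in absolute value, hence non-zero modulo [v].
    Thus the partial sums of every row and column are non-zero and distinct. *)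
Require Import Defs.
From mathcomp Require Import all_boot all_order all_algebra all_fingroup.
From mathcomp Require Import cyclic zify ring.
Set Implicit Arguments.
Unset Strict Implicit.
Unset Printing Implicit Defensive.
Import GRing.Theory.
Local Open Scope ring_scope.

Lemma partial_sums_cons (V : zmodType) (x : V) (s : seq V) :
  partial_sums (x :: s) = [seq x + y | y <- 0 :: partial_sums s].
Proof.
rewrite /partial_sums /= add0r addr0; congr cons.
have scanlD y : scanl (fun x y => x + y) (x + y) s =
    [seq x + z | z <- scanl (fun x y => x + y) y s].
  by elim: s y => //= z s IHs y; rewrite -addrA IHs.
by rewrite -scanlD addr0.
Qed.

Lemma sum_mem_partial_sums (V : zmodType) (s : seq V) :
  s != [::] -> \sum_(x <- s) x \in partial_sums s.
Proof.
elim: s => // x s IHs _; rewrite big_cons partial_sums_cons map_f // inE.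
by case: s IHs => [|y s] IHs; rewrite ?big_nil ?eqxx // IHs ?orbT.
Qed.

Section Alternating.

Variables (R : comPzRingType) (n v : nat) (f : nat -> nat) (e : nat).
Hypothesis natr_neq0 : forall c, (0 < c < v)%N -> c%:R != 0 :> R.
Hypothesis f_gt0 : forall j, (j < n)%N -> (0 < f j)%N.
Hypothesis f_lt : forall j, (j < n)%N -> (f j < v)%N.
Hypothesis f_mono : forall j, (j.+1 < n)%N -> (f j < f j.+1)%N.

(** The entries at positions [a] to [a + l - 1] of one line of the array; [e] will be the index of
    that row or column and fixes its first sign. A variable start [a] lets inductions drop the first
    entry. *)
Let alternating a l : seq R := [seq (-1) ^+ (e + j) * (f j)%:R | j <- iota a l].

(** The two cases feed each other when an entry is put in front. A tail sum with the sign of its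
    first entry has [c >= f a.+1 > f a], so the difference [c - f a] stays positive; one with the
    opposite sign has [c < v - f a.+1], so [f a + c] stays below [v]. *)
Lemma alternating_partial_sums a l y : (a + l <= n)%N ->
  y \in partial_sums (alternating a l) ->
  exists2 c : nat, (0 < c < v)%N &
    (f a <= c)%N /\ y = (-1) ^+ (e + a) * c%:R
    \/ (c < v - f a)%N /\ y = - ((-1) ^+ (e + a) * c%:R).
Proof.
elim: l a y => [|l IHl] a y // le_aln.
have fa_gt0 := @f_gt0 a ltac:(lia); have fa_lt := @f_lt a ltac:(lia).
rewrite [alternating _ _]/= partial_sums_cons => /mapP[z].
rewrite inE => /predU1P[-> ->|z_sum ->].
  by exists (f a); [lia | left; rewrite addr0].
have l_gt0 : (0 < l)%N by case: (l) z_sum.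
have ltf := @f_mono a ltac:(lia); have f1_lt := @f_lt a.+1 ltac:(lia).
have [c c_bd [[le_c ->]|[lt_c ->]]] := IHl a.+1 z ltac:(lia) z_sum.
  exists (c - f a)%N; first lia.
  by right; split; [lia | rewrite natrB; [rewrite addnS exprS; ring | lia]].
exists (f a + c)%N; first lia.
by left; split; [lia | rewrite natrD addnS exprS; ring].
Qed.

Lemma alternating_partial_sums_neq0 a l : (a + l <= n)%N ->
  0 \notin partial_sums (alternating a l).
Proof.
move=> le_aln; apply/negP => /(alternating_partial_sums le_aln)[c c_bd].
have nz : (-1) ^+ (e + a) * c%:R != 0 :> R.
  apply: contraNneq (natr_neq0 c_bd) => /(congr1 ( *%R ((-1) ^+ (e + a)))).
  by rewrite signrMK mulr0 => ->.
by case=> -[_ /esym/eqP]; rewrite ?oppr_eq0 (negPf nz).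
Qed.

Lemma alternating_simple a l : (a + l <= n)%N ->
  simple_ordering (alternating a l).
Proof.
move=> le_aln; rewrite /simple_ordering.
elim: l a le_aln => [|l IHl] a le_aln //.
rewrite alternating_partial_sums_neq0 // andTb.
(* Up to translation by the first entry, the partial sums are 0 followed by those of the tail, so
   their distinctness is exactly simplicity of the tail. *)
rewrite [alternating _ _]/= partial_sums_cons map_inj_uniq; last exact: addrI.
by rewrite cons_uniq; apply: IHl; lia.
Qed.

Lemma alternating_sum_neq0 : (0 < n)%N ->
  \sum_(j < n) (-1) ^+ (e + j) * (f j)%:R != 0 :> R.
Proof.
move=> n_gt0; have := @alternating_partial_sums_neq0 0 n (leqnn n).
apply: contraNneq => <-; set F := fun j => (-1) ^+ (e + j) * (f j)%:R : R.
rewrite -(big_mkord xpredT F) /index_iota subn0 -(big_map F xpredT id).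
by apply: sum_mem_partial_sums; case: (n) n_gt0.
Qed.

Lemma alternating_has_simple_natural_ordering : (0 < n)%N ->
  has_simple_natural_ordering [seq (-1) ^+ (e + j) * (f j)%:R : R | j : 'I_n <- enum 'I_n].
Proof.
move=> n_gt0; exists 0; first by rewrite size_map size_enum_ord.
set F := fun j => (-1) ^+ (e + j) * (f j)%:R : R.
by rewrite rot0 (map_comp F val) val_enum_ord alternating_simple.
Qed.

End Alternating.

Section NonMultiples.

Variables (q : nat).
Hypothesis q_gt0 : (0 < q)%N.

Definition nonmultiple (k : nat) : nat := (k + k %/ q).+1.

Lemma nonmultiple_mono : {homo nonmultiple : j k / (j < k)%N}.
Proof.
by move=> j k lt_jk; have := leq_div2r q (ltnW lt_jk); rewrite /nonmultiple; lia.
Qed.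

(** From [2k + 2 <= qt] and [q (k %/ q) <= k] follows [2 (k %/ q) < t]; adding this to the first
    bound gives the claim. *)
Lemma nonmultiple_lt N t k : (2 * N = q * t)%N -> (k < N)%N ->
  (2 * nonmultiple k < q.+1 * t)%N.
Proof. by rewrite /nonmultiple => Nqt lt_kN; have := leq_trunc_div k q; nia. Qed.

Lemma nonmultiple_onto N t x : (2 * N = q * t)%N -> ~~ (q.+1 %| x)%N ->
  (2 * x < q.+1 * t)%N -> exists2 k, (k < N)%N & x = nonmultiple k.
Proof.
move=> Nqt ndvd lt_x; move: ndvd; rewrite /dvdn -lt0n => b_gt0.
have b_lt := @ltn_pmod x q.+1 isT; have := divn_eq x q.+1.
move: (x %/ q.+1)%N (x %% q.+1)%N b_gt0 b_lt => a b b_gt0 b_lt x_ab.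
(* Each of the [a] full blocks of length [q.+1] below [x] holds [q] non-multiples, and [b.-1] more
   precede [x] in its own block. *)
exists (a * q + b.-1)%N; last first.
  by rewrite /nonmultiple divnMDl // divn_small; nia.
(* If [2a + 2 <= t], then [b <= q] suffices; [t <= 2a] contradicts the bound on [x]; if
   [t = 2a + 1], that bound gives [2b <= q]. *)
have [le_at|lt_ta] := leqP (2 * a).+2 t; first by nia.
have [le_ta|lt_at] := leqP t (2 * a); first by nia.
have t_eq : t = (2 * a).+1 by lia.
by subst t; nia.
Qed.

End NonMultiples.

Lemma Zp_multiples_group (v m : nat) : (1 < v)%N -> (m %| v)%N ->
  exists2 J : {group 'Z_v}, #|J| = (v %/ m)%N
    & forall x : 'Z_v, (x \in J) = (m %| x)%N.
Proof.
move=> v_gt1 m_dvd; have vE := Zp_cast v_gt1.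
(* The group law of ['Z_v] is written multiplicatively here, so this generator is the residue of
   [m]. *)
exists <[(Zp1 : 'Z_v) ^+ m]>%G.
  by rewrite -orderE orderXdiv order_Zp1 vE.
move=> x; apply/idP/idP => [/cycleP[k ->]|/dvdnP[k xE]].
  by rewrite -expgM Zp_expg /= vE modnMml mul1n /dvdn modn_dvdm // modnMr.
apply/cycleP; exists k; rewrite -expgM Zp_expg; apply: val_inj.
by rewrite /= modnMml mul1n mulnC -xE modn_small.
Qed.

Local Close Scope ring_scope.

Theorem theorem3p19 (n t : nat) (n_prime : prime n) (t_gt0 : 0 < t)
    (t_dvd : t %| 2 * n ^ 2) :
  exists A : 'M['Z_(heffter_modulus n t)]_n, is_NH A /\ globally_simple A.
Proof.
have n_gt0 := prime_gt0 n_prime.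
set v := heffter_modulus n t; have [q Nqt] := dvdnP t_dvd.
have vE : v = q.+1 * t by rewrite /v /heffter_modulus; lia.
have q_gt0 : 0 < q by nia.
have v_gt1 : 1 < v by nia.
have vZ := Zp_cast v_gt1.
have natr_neq0 c : 0 < c < v -> (c%:R != 0 :> 'Z_v)%R.
  case/andP=> c_gt0 c_lt; rewrite -val_eqE /= val_Zp_nat // modn_small //.
  by rewrite -lt0n.
pose f i j := nonmultiple q (i * n + j).
have cell_lt i j : i < n -> j < n -> i * n + j < n ^ 2 by nia.
have f_lt i j : i < n -> j < n -> f i j < v.
  move=> lt_i lt_j; have := nonmultiple_lt q_gt0 Nqt (cell_lt i j lt_i lt_j).
  by rewrite -vE; apply: leq_ltn_trans; rewrite leq_pmull.
have q1_dvd : q.+1 %| v by rewrite vE dvdn_mulr.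
have [J cardJ memJ] := Zp_multiples_group v_gt1 q1_dvd.
pose A : 'M['Z_v]_n := (\matrix_(i, j) ((-1) ^+ (i + j) * (f i j)%:R))%R.
exists A; split; last first.
  split=> k; rewrite /row_seq /col_seq.
    under eq_map do rewrite mxE.
    apply: (@alternating_has_simple_natural_ordering _ n v (f k)) => // j.
    - by move=> lt_j; apply: f_lt.
    - by move=> _; apply: nonmultiple_mono; lia.
  (* Commuting the exponent puts the column index in the role of [e]; down a column the argument of
     [nonmultiple] grows by [n]. *)
  under eq_map do rewrite mxE addnC.
  apply: (@alternating_has_simple_natural_ordering _ n v (f^~ k)) => // j.
  - by move=> lt_j; apply: f_lt.
  - by move=> _; apply: nonmultiple_mono; nia.
exists J; split.
- by rewrite cardJ vE mulKn.
- have sub x : x \in enum (~: J) -> x \in pm_entries A.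
    rewrite mem_enum inE memJ => x_ndvd.
    (* Both signs are claimed at once: a residue below [v/2] uses [y = x], one above it uses
       [y = v - x], whose opposite is [x]. *)
    have mem_cell y : ~~ (q.+1 %| y) -> 2 * y < q.+1 * t ->
        ((y%:R \in pm_entries A) && (- y%:R \in pm_entries A))%R.
      move=> ndvd /(nonmultiple_onto q_gt0 Nqt ndvd)[k lt_k ->].
      have k_div : k %/ n < n by rewrite ltn_divLR // mulnn.
      pose i := Ordinal k_div; pose j := Ordinal (ltn_pmod k n_gt0).
      have A_in : A i j \in entries A by apply: allpairs_f; rewrite mem_enum.
      have AN_in : (- A i j)%R \in [seq (- z)%R | z <- entries A] by apply: map_f.
      have fE : f i j = nonmultiple q k by rewrite /f /= -divn_eq.
      move: A_in AN_in; rewrite !mem_cat mxE fE -signr_odd.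
      case: odd; rewrite ?(expr1, expr0) ?mulN1r ?mul1r ?opprK => -> ->;
        by rewrite ?orbT.
    have lt_x : x < v by have := ltn_ord x; rewrite [X in _ < X]vZ.
    have [lt2x|le2x] := ltnP (2 * x) (q.+1 * t).
      by have /andP[+ _] := mem_cell x x_ndvd lt2x; rewrite natr_Zp.
    have vx_ndvd : ~~ (q.+1 %| v - x).
      by rewrite dvdn_subr // ?(ltnW lt_x).
    (* The midpoint lies in [J]: if [v = 2n^2 + t] is even, so is [t], and [v/2] is the multiple
       [q.+1 * t./2]. *)
    have neq2x : 2 * x <> v.
      move=> x2; have t_even : ~~ odd t.
        have : odd v = odd t by rewrite /v /heffter_modulus oddD oddM.
        by rewrite -x2 oddM => <-.
      have xE : nat_of_ord x = q.+1 * t./2 by have := even_halfK t_even; nia.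
      by rewrite xE dvdn_mulr in x_ndvd.
    have /andP[_] := mem_cell _ vx_ndvd ltac:(lia).
    by rewrite natrB ?(ltnW lt_x) // pchar_Zp // natr_Zp sub0r opprK.
  (* The [2n^2] values [+x, -x] cover the [2n^2] elements outside [J]: no repetition. *)
  have size_pm : size (pm_entries A) = size (enum (~: J)).
    rewrite size_cat size_map size_allpairs size_enum_ord -cardE cardsCs setCK.
    by rewrite card_ord vZ cardJ vE mulKn //; lia.
  have [_ eq_mem] := uniq_min_size (enum_uniq _) sub (eq_leq size_pm).
  rewrite perm_sym; apply: uniq_perm => //; first exact: enum_uniq.
  by apply: (leq_size_uniq (enum_uniq _) sub); rewrite size_pm.
- move=> i; under eq_bigr do rewrite mxE.
  apply: (@alternating_sum_neq0 _ n v (f i)) => // j.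
  + by move=> lt_j; apply: f_lt.
  + by move=> _; apply: nonmultiple_mono; lia.
- move=> j; under eq_bigr do rewrite mxE addnC.
  apply: (@alternating_sum_neq0 _ n v (f^~ j)) => // i.
  + by move=> lt_i; apply: f_lt.
  + by move=> _; apply: nonmultiple_mono; nia.
Qed.
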